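(* Every finite semigroup divides an iterated $\lambda\rho$-product whose factors are finite simple groups and a two-element semilattice. That is, for every finite semigroup $\mathbf{A}$ there is a semigroup $\mathbf{B}\in\mathcal{C}$ such that $\mathbf{A}$ divides $\mathbf{B}$, where $\mathcal{C}$ is the smallest class of semigroups that contains all finite simple groups and the two-element semilattice and is closed under forming $\lambda\rho$-products $\mathbf{H}^{[\mathcal{S}]}$ with $\mathbf{H}\in\mathcal{C}$ and $\mathcal{S}$ any $\lambda\rho$-system over a semigroup $\mathbf{S}\in\mathcal{C}$.
   Context: Semigroups are nonempty. A semigroup $\mathbf{A}$ divides a semigroup $\mathbf{B}$ if $\mathbf{A}$ is a homomorphic image of a subsemigroup of $\mathbf{B}$. The two-element semilattice is regarded as a semigroup (it is $(\{0,1\},\vee)$ up to isomorphism). Composition of maps is $(g\circ f)(x)=g(f(x))$. A $\lambda\rho$-system over a semigroup $\mathbf{S}$ (with universe $S$) is a triple $(\mathbf{I},\boldsymbol{\lambda},\boldsymbol{\rho})$ consisting of a family of sets $\mathbf{I}=(I[s])_{s\in S}$ and, for every $(a,b)\in S^2$, maps $\lambda[a,b]\colon I[ab]\to I[a]$ and $\rho[a,b]\colon I[ab]\to I[b]$ such that for all $a,b,c\in S$: ($\alpha$) $\lambda[a,b]\circ\lambda[ab,c]=\lambda[a,bc]$; ($\beta$) $\rho[b,c]\circ\rho[a,bc]=\rho[ab,c]$; ($\gamma$) $\rho[a,b]\circ\lambda[ab,c]=\lambda[b,c]\circ\rho[a,bc]$. For a semigroup $\mathbf{H}$ (with universe $H$)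 and a $\lambda\rho$-system $\mathcal{S}$ over $\mathbf{S}$, the $\lambda\rho$-product $\mathbf{H}^{[\mathcal{S}]}$ is the semigroup with universe $\{(x,a): a\in S,\ x\in H^{I[a]}\}$, where $H^{I[a]}$ is the set of all maps $I[a]\to H$, and operation $(x,a)\star(y,b)=\bigl((x\circ\lambda[a,b])\cdot(y\circ\rho[a,b]),\,ab\bigr)$, with $\cdot$ computed pointwise in $H^{I[ab]}$. *)

(* Defs.v *)
From HB Require Import structures.
From mathcomp Require Import all_boot all_fingroup all_solvable.
From mathcomp Require Import boolp classical_sets functions cardinality.

Set Implicit Arguments.
Unset Strict Implicit.
Unset Printing Implicit Defensive.

Local Open Scope classical_set_scope.
Local Open Scope group_scope.

(* A [semigroupType] may be empty and carries a choice structure.  The latter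
   is no restriction classically; nonemptiness is stated where it is needed. *)

Definition isomorphic (A B : semigroupType) : Prop :=
  exists f : {multiplicative A -> B}, bijective f.

Definition subsemigroup (B : semigroupType) (U : set B) : Prop :=
  U !=set0 /\ forall x y, U x -> U y -> U (x * y).

(* The homomorphism is only required to be one on U, and its values outside U
   are irrelevant. *)
Definition divides (A B : semigroupType) : Prop :=
  exists (U : set B) (f : B -> A),
    [/\ subsemigroup U,
        forall x y, U x -> U y -> f (x * y) = f x * f y
      & f @` U = [set: A]].

Definition finite_simple_group (A : semigroupType) : Prop :=
  exists gT : finGroupType, simple [set: gT]%SET /\ isomorphic A gT.

Definition bool_or : Type := bool.
HB.instance Definition _ := Choice.on bool_or.
HB.instance Definition _ := isSemigroup.Build bool_or orbA.

Definition two_element_semilattice (A : semigroupType) : Prop :=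
  isomorphic A bool_or.

Definition icast (T : Type) (I : T -> Type) (a b : T) (e : a = b) (i : I a) :
  I b := ecast t (I t) e i.

(* The equations (alpha), (beta), (gamma) are stated pointwise for
   i : I[a(bc)].  The sets I[(ab)c] and I[a(bc)] are equal by associativity but
   not convertible, whence the casts. *)
Record lrsystem (S : semigroupType) := LRSystem {
  idx : S -> Type;
  lam : forall a b, idx (a * b) -> idx a;
  rho : forall a b, idx (a * b) -> idx b;
  lrsys_alpha : forall a b c (i : idx (a * (b * c))),
    lam (lam (icast (mulgA a b c) i)) = lam i;
  lrsys_beta : forall a b c (i : idx (a * (b * c))),
    rho (rho i) = rho (icast (mulgA a b c) i);
  lrsys_gamma : forall a b c (i : idx (a * (b * c))),
    rho (lam (icast (mulgA a b c) i)) = lam (rho i)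
}.

(* The pair (x, a) is encoded as [existT _ a x]. *)
Definition lrprod (H S : semigroupType) (Sys : lrsystem S) : Type :=
  {a : S & idx Sys a -> H}.

Section LRProduct.
Variables (H S : semigroupType) (Sys : lrsystem S).

Definition lrprod_mul (u v : lrprod H Sys) : lrprod H Sys :=
  existT (fun c => idx Sys c -> H) (projT1 u * projT1 v)
    (fun i => projT2 u (lam i) * projT2 v (rho i)).

Lemma lrprod_eq (a b : S) (e : a = b) (x : idx Sys a -> H)
    (y : idx Sys b -> H) :
  (forall i, x i = y (icast e i)) ->
  existT _ a x = existT _ b y :> lrprod H Sys.
Proof. by case: b / e y => y xy; congr existT; apply: funext. Qed.

Lemma lrprod_mulA : associative lrprod_mul.
Proof.
move=> [a x] [b y] [c z]; apply: (lrprod_eq (e := mulgA a b c)) => i /=.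
by rewrite lrsys_alpha lrsys_gamma -lrsys_beta mulgA.
Qed.

HB.instance Definition _ := gen_eqMixin (lrprod H Sys).
HB.instance Definition _ := gen_choiceMixin (lrprod H Sys).
HB.instance Definition _ := isSemigroup.Build (lrprod H Sys) lrprod_mulA.

End LRProduct.

(* The class C; its members are nonempty, the generators being nonempty. *)
Inductive iterated_lrprod : semigroupType -> Prop :=
| ilrp_simple (G : semigroupType) :
    finite_simple_group G -> iterated_lrprod G
| ilrp_semilattice (L : semigroupType) :
    two_element_semilattice L -> iterated_lrprod L
| ilrp_prod (H S : semigroupType) (Sys : lrsystem S) :
    iterated_lrprod H -> iterated_lrprod S ->
    iterated_lrprod (lrprod H Sys).

(* Main.v *)
Require Import Defs.
From mathcomp Require Import all_boot all_fingroup all_solvable.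
From mathcomp Require Import finmap.
From mathcomp Require Import boolp classical_sets functions cardinality.

(** Division is handled through words.  A function of words over an alphabet L
    is [recognizable] when some member B of the class and some labelling of the
    letters by elements of B are such that the product in B of the labels of a
    word determines the value of the function.  A semigroup A divides a member
    of the class as soon as the evaluation of words over A is recognizable
    ([divides_of_recognizable]): send the product of the labels of a word to
    the value of that word.

    All uses of lambda-rho-products go through one closure property,
    [recognizable_transduce].  Rewrite a word by replacing each letter with a
    new letter that depends on it, on a recognizable value of the prefix before
    it and on a recognizable value of the suffix after it; a recognizable
    function of the rewritten word is a recognizable function of the original
    one.  The lambda-rho-system behind it has as indices the pairs of a left
    and a right context in S with a unit adjoined, lambda and rho absorbing a
    factor into one of the contexts.  Since both contexts are available, the
    semilattice is enough to test whether a letter occurs before or after a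
    position, and the flip-flop (a two-element right zero semigroup with a unit)
    of the classical Krohn-Rhodes theorem does not have to be a factor.

    Evaluation in a finite group is reduced to simple groups along a normal
    subgroup N and its quotient, by telescoping coset representatives
    ([recognizable_group]).  Evaluation in a finite monoid P is reduced to
    groups by local divisors ([recognizable_monoid]).  If every letter value
    has a left inverse, the letters act on P by permutations.  Otherwise some
    letter value c has none, and a word factors around its occurrences of c as
    w0 c w1 c ... c wk.  The blocks w0 and wk are read off by testing whether c
    occurs before or after a position, and they use one generator less.  The
    middle part c w1 c ... c is the product of the elements c wi c, 0 < i < k, in the local
    divisor at c, the set Pc :&: cP with the product (xc, cy) |-> xcy and the
    unit c, which is smaller than P since it does not contain the unit of P.
    Hence an induction on the size of P and then on the number of generators. *)

Set Implicit Arguments.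
Unset Strict Implicit.
Unset Printing Implicit Defensive.

Local Open Scope classical_set_scope.
Local Open Scope group_scope.

(** * Words and recognizable functions *)

Section WordValue.
Variables (L T : Type) (op : T -> T -> T) (e : T).

Definition word_value (h : L -> T) (w : seq L) : T :=
  foldr (fun a => op (h a)) e w.

End WordValue.

(** The empty word gets the value [None], so that a semigroup without unit can
    evaluate all words, and also contexts that are empty on one side. *)
Definition adjoin_one (T : Type) (op : T -> T -> T) (u v : option T) :=
  match u, v with
  | None, _ => v
  | _, None => u
  | Some x, Some y => Some (op x y)
  end.

Arguments adjoin_one {T} op !u !v.

Lemma adjoin_oneA (T : Type) (op : T -> T -> T) :
  associative op -> associative (adjoin_one op).
Proof. by move=> opA [x|] [y|] [z|] //=; rewrite opA. Qed.

Lemma adjoin_one0 (T : Type) (op : T -> T -> T) : right_id None (adjoin_one op).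
Proof. by case. Qed.

Notation semigroup_value g :=
  (word_value (adjoin_one *%g) None (fun a => Some (g a))).

Lemma semigroup_value_cat (L : Type) (B : semigroupType) (g : L -> B) w1 w2 :
  semigroup_value g (w1 ++ w2) =
  adjoin_one *%g (semigroup_value g w1) (semigroup_value g w2).
Proof.
by elim: w1 => [|a w1 IH] //=; rewrite IH; apply: adjoin_oneA mulgA _ _ _.
Qed.

Definition recognizable (L Y : Type) (phi : seq L -> Y) : Prop :=
  exists2 B : semigroupType, iterated_lrprod B &
  exists g : L -> B, forall w w',
    semigroup_value g w = semigroup_value g w' -> phi w = phi w'.

Lemma recognizable_comp (L Y Z : Type) (phi : seq L -> Y) (f : Y -> Z) :
  recognizable phi -> recognizable (fun w => f (phi w)).
Proof.
by case=> B CB [g gP]; exists B => //; exists g => w w' /gP ->.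
Qed.

Lemma recognizable_ext (L Y : Type) (phi psi : seq L -> Y) :
  phi =1 psi -> recognizable phi -> recognizable psi.
Proof.
by move=> e [B CB [g gP]]; exists B => //; exists g => w w' /gP; rewrite !e.
Qed.

(** The function through which v factors when v is constant on the fibers of
    u; z0 is its value outside the image of u. *)
Definition fiber_value (X Y Z : Type) (u : X -> Y) (v : X -> Z) (z0 : Z) (y : Y) : Z :=
  if pselect (exists x, u x = y) is left ex then v (projT1 (cid ex)) else z0.

Lemma fiber_valueE (X Y Z : Type) (u : X -> Y) (v : X -> Z) z0 x :
  (forall x x', u x = u x' -> v x = v x') -> fiber_value u v z0 (u x) = v x.
Proof.
rewrite /fiber_value => uv; case: pselect => [ex|]; last by case; exists x.
by case: cid => x' /= /uv.
Qed.

(** * Two-sided transductions and the context system *)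

Section Transduction.
Variables (L A L' : Type) (alpha : seq L -> A) (k : A -> L -> A -> L').

Fixpoint transduce (pre w post : seq L) : seq L' :=
  if w is a :: s then
    k (alpha pre) a (alpha (s ++ post)) :: transduce (rcons pre a) s post
  else [::].

End Transduction.

Section ContextSystem.
Variable S : semigroupType.
Notation S1 := (option S).
Let context : S -> Type := fun _ => (S1 * S1)%type.

Lemma icast_context a b (e : a = b) (i : context a) : icast e i = i.
Proof. by case: b / e. Qed.

Let ctx_lam a b : context (a * b) -> context a :=
  fun i => (i.1, adjoin_one *%g (Some b) i.2).
Let ctx_rho a b : context (a * b) -> context b :=
  fun i => (adjoin_one *%g i.1 (Some a), i.2).

Let ctx_alpha a b c (i : context (a * (b * c))) :
  ctx_lam (ctx_lam (icast (mulgA a b c) i)) = ctx_lam i.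
Proof.
by rewrite icast_context; case: i => u [v|] //=; rewrite /ctx_lam /= mulgA.
Qed.

Let ctx_beta a b c (i : context (a * (b * c))) :
  ctx_rho (ctx_rho i) = ctx_rho (icast (mulgA a b c) i).
Proof.
by rewrite icast_context; case: i => [[u|] v] //=; rewrite /ctx_rho /= mulgA.
Qed.

Let ctx_gamma a b c (i : context (a * (b * c))) :
  ctx_rho (ctx_lam (icast (mulgA a b c) i)) = ctx_lam (ctx_rho i).
Proof. by rewrite icast_context. Qed.

(** Alpha and beta say that a product of two factors is absorbed one factor at
    a time, and gamma that the left and right contexts do not interact. *)
Definition context_system : lrsystem S :=
  LRSystem ctx_alpha ctx_beta ctx_gamma.

End ContextSystem.

(** Let S recognize alpha and H recognize phi.  In the product of H by the
    context system over S, label a letter a by its S-label together with the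
    function that sends a pair of contexts to the H-label of the letter that
    replaces a between them.  The product of a word then has as function part
    the H-value of the rewritten word in every pair of contexts, and the pair
    of empty contexts gives the statement.  The S-part comes for free, which is
    what yields pairs of recognizable functions. *)
Lemma recognizable_transduce (L A L' Y : Type) (alpha : seq L -> A)
    (k : A -> L -> A -> L') (phi : seq L' -> Y) :
  recognizable alpha -> recognizable phi ->
  recognizable (fun w => (alpha w, phi (transduce alpha k [::] w [::]))).
Proof.
case=> S CS [g gP] [H CH [g' g'P]].
pose val := fiber_value (semigroup_value g) alpha (alpha [::]).
have valE w : val (semigroup_value g w) = alpha w by exact: fiber_valueE.
exists (lrprod H (context_system S)); first exact: ilrp_prod.
pose G a : lrprod H (context_system S) :=
  existT (fun c => idx (context_system S) c -> H) (g a)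
    (fun i => g' (k (val i.1) a (val i.2))).
exists G.
have GP w : if semigroup_value G w is Some b then
    semigroup_value g w = Some (projT1 b) /\
    forall pre post, semigroup_value g' (transduce alpha k pre w post) =
      Some (projT2 b (semigroup_value g pre, semigroup_value g post))
  else w = [::].
  elim: w => [|a w IH] //=.
  case: (semigroup_value G w) IH => [b [IH1 IH2]|->] /=; last first.
    by split=> // pre post /=; rewrite !valE.
  split=> [|pre post]; first by rewrite IH1.
  rewrite IH2 /= -IH1 -semigroup_value_cat !valE.
  by rewrite -cats1 semigroup_value_cat.
move=> w w' eGw.
have [Ew Ew'] := (GP w, GP w').
case: (semigroup_value G w) eGw Ew => [b|] eGw; last first.
  by move: Ew'; rewrite -eGw => -> ->.
move: Ew'; rewrite -eGw => -[e1' e2'] [e1 e2].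
by congr pair; [apply: gP; rewrite e1 e1' | apply: g'P; rewrite e2 e2'].
Qed.

Lemma transduce_const (L A L' : Type) (alpha : seq L -> A) (f : L -> L') pre w post :
  transduce alpha (fun _ a _ => f a) pre w post = map f w.
Proof. by elim: w pre => [|a w IH] pre //=; rewrite IH. Qed.

(** The transduction that copies each letter and ignores its contexts. *)
Lemma recognizable_pair (L Y Z : Type) (phi : seq L -> Y) (psi : seq L -> Z) :
  recognizable phi -> recognizable psi ->
  recognizable (fun w => (phi w, psi w)).
Proof.
move=> rphi rpsi.
have := recognizable_transduce (fun _ a _ => a) rphi rpsi.
by apply: recognizable_ext => w; rewrite transduce_const map_id.
Qed.

(** * The generators and finite groups *)

Lemma bool_or_iterated : iterated_lrprod bool_or.
Proof.
apply: ilrp_semilattice; exists idfun; exact: inv_bij.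
Qed.

Lemma recognizable_has (L : Type) (p : pred L) : recognizable (has p).
Proof.
exists bool_or; first exact: bool_or_iterated.
exists p => w w' eww'.
suff hasE u : has p u = odflt false (semigroup_value (p : L -> bool_or) u).
  by rewrite !hasE eww'.
by elim: u => [|a u /= ->] //; case: (word_value _ _ _ _) => [b|] //=; rewrite orbF.
Qed.

Lemma recognizable_const (L Y : Type) (y : Y) : recognizable (fun _ : seq L => y).
Proof. exact: recognizable_comp (recognizable_has xpred0). Qed.

Lemma recognizable_simple (gT : finGroupType) (L : Type) (h : L -> gT) :
  simple [set: gT]%SET -> recognizable (word_value *%g 1 h).
Proof.
move=> simT; exists gT.
  apply: ilrp_simple; exists gT; split=> //; exists idfun; exact: inv_bij.
exists h => w w' eww'.
suff valE u : word_value *%g 1 h u = odflt 1 (semigroup_value h u).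
  by rewrite !valE eww'.
by elim: u => [|a u /= ->] //; case: (word_value _ _ _ _) => [b|] //=; rewrite mulg1.
Qed.

(** With r a choice of coset representatives and q the evaluation modulo N,
    the elements (r (q (a :: s)))^-1 * a * r (q s) lie in N, and their product
    along a word telescopes to the value of the word up to the representatives
    at both ends. *)
Lemma recognizable_group (L : Type) (gT : finGroupType) (G : {group gT}) (h : L -> gT) :
  (forall a, h a \in G) -> recognizable (word_value *%g 1 h).
Proof.
have [n] := ubnP #|G|; elim: n => // n IH in L gT G h *.
rewrite ltnS => leGn hG.
have [simG|nsimG] := boolP (simple G).
  have simT : simple [set: subg_of G]%SET by rewrite -(isog_simple (isog_subg G)).
  have := recognizable_comp sgval (recognizable_simple (fun a => subg G (h a)) simT).
  apply: recognizable_ext => w.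
  by elim: w => [|a w IHw] //=; rewrite -IHw subgK.
have [G1|ntG] := eqVneq (G : {set gT}) 1%g.
  apply: recognizable_ext (recognizable_const _ 1) => w.
  elim: w => [|a w IHw] //=; rewrite -IHw.
  by have := hG a; rewrite G1 => /set1P ->; rewrite mulg1.
have [N nsNG [ntN neqNG]] : exists2 N : {group gT}, N <| G & N :!=: 1%g /\ N :!=: G.
  apply: contrapT => noN; move/negP: nsimG; apply; apply/simpleP; split=> // N nsNG.
  have [->|ntN] := eqVneq (N : {set gT}) 1%g; first by left.
  have [->|neqNG] := eqVneq (N : {set gT}) G; first by right.
  by case: noN; exists N.
have [sNG nNG] := andP nsNG.
pose q w := word_value *%g 1 (fun a => coset N (h a)) w.
have recq : recognizable q.
  apply: (IH _ _ (G / N)%G); last by move=> a; rewrite mem_quotient.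
  by apply: leq_trans leGn; rewrite ltn_quotient.
pose r (x : coset_of N) : gT := repr x.
have rN x : r x \in 'N(N) by exact: repr_coset_norm.
pose step (_ : coset_of N) (a : L) (x : coset_of N) := (a, x).
pose u (ax : L * coset_of N) : gT :=
  (r (coset N (h ax.1) * ax.2))^-1 * h ax.1 * r ax.2.
have uN ax : u ax \in N.
  have hN : h ax.1 \in 'N(N) by exact: (fintype.subsetP nNG).
  apply: coset_idr; first by rewrite !groupM ?groupV.
  by rewrite !morphM ?morphV ?groupM ?groupV //= !coset_reprK invMg mulgKV mulVg.
have recu : recognizable (word_value *%g 1 u).
  apply: (IH _ _ N) => //; apply: leq_trans leGn.
  by rewrite proper_card // finset.properEneq neqNG.
have telescope pre w :
  word_value *%g 1 u (transduce q step pre w [::]) =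
  (r (q w))^-1 * word_value *%g 1 h w * r 1.
  elim: w pre => [|a w IHw] pre /=; first by rewrite mulg1 mulVg.
  by rewrite IHw cats0 /u /= !mulgA mulgK.
have := recognizable_comp (fun xy => r xy.1 * xy.2 * (r 1)^-1)
  (recognizable_transduce step recq recu).
by apply: recognizable_ext => w; rewrite telescope /= !mulgA mulgV mul1g mulgK.
Qed.

(** * Monoids and local divisors *)

(** Monoids are given by an operation and a subset of one fixed finite type, so
    that a monoid and its local divisors share a carrier. *)
Definition monoid_on (T : finType) (op : T -> T -> T) (e : T) (P : {set T}) : Prop :=
  [/\ e \in P, {in P &, forall x y, op x y \in P},
      {in P & &, associative op}, {in P, left_id e op} & {in P, right_id e op}].

Lemma word_value_in (T : finType) (op : T -> T -> T) e (P : {set T}) (L : Type)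
    (h : L -> T) w :
  monoid_on op e P -> (forall a, h a \in P) -> word_value op e h w \in P.
Proof.
by move=> [eP opP _ _ _] hP; elim: w => [|a w IH] //=; apply: opP.
Qed.

(** The local divisor at c.  The product of xc and cy is xcy; it depends on x
    only through xc and on y only through cy, so a preimage chosen for the left
    factor does not matter. *)
Section LocalDivisor.
Variables (T : finType) (op : T -> T -> T) (e c : T) (P : {set T}).
Hypothesis monP : monoid_on op e P.
Hypothesis cP : c \in P.

Definition local_set : {set T} :=
  [set x in [set op m c | m in P] | x \in [set op c m | m in P]]%SET.

Definition local_op (x y : T) : T :=
  op (odflt e [pick m in P | op m c == x]) y.

Lemma local_setP x :
  reflect (exists m n, [/\ m \in P, n \in P, x = op m c & x = op c n])
          (x \in local_set).
Proof.
rewrite inE; apply: (iffP andP) => [[/imsetP[m mP ->] /imsetP[n nP e']]|].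
  by exists m, n.
by case=> m [n [mP nP e1 e2]]; split; apply/imsetP; [exists m|exists n].
Qed.

Lemma local_sub x : x \in local_set -> x \in P.
Proof.
by case: monP => _ opP _ _ _ /local_setP[m [n [mP nP -> _]]]; apply: opP.
Qed.

Lemma local_opE m y : m \in P -> y \in local_set -> local_op (op m c) y = op m y.
Proof.
case: monP => _ opP opA _ _ mP /local_setP[_ [n [_ nP _ ->]]].
rewrite /local_op; case: pickP => [m' /andP[m'P /eqP e']|/(_ m)] /=.
  by rewrite !opA // e'.
by rewrite mP eqxx.
Qed.

Lemma local_unit_in : c \in local_set.
Proof.
case: monP => eP _ _ op1 opr1; apply/local_setP; exists e, e.
by rewrite op1 ?opr1.
Qed.

Lemma local_monoid : monoid_on local_op c local_set.
Proof.
have [eP opP opA op1 opr1] := monP.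
have loc_in x y : x \in local_set -> y \in local_set -> local_op x y \in local_set.
  move=> /local_setP[m [n [mP nP e1 e2]]] yL.
  case/local_setP: (yL) => [m' [n' [m'P n'P e1' e2']]].
  apply/local_setP; exists (op m m'), (op n n').
  rewrite !opP //; split=> //; rewrite {1}e1 local_opE //.
    by rewrite e1' opA.
  by rewrite e2' !opA // -e1 e2.
split.
- exact: local_unit_in.
- by move=> x y xL yL; apply: loc_in.
- move=> x y z xL yL zL.
  case/local_setP: (xL) => [m [_ [mP _ -> _]]].
  case/local_setP: (yL) => [m' [_ [m'P _ e' _]]].
  have zP := local_sub zL.
  rewrite local_opE ?loc_in // [local_op (op m c) y]local_opE //.
  have -> : op m y = op (op m m') c by rewrite e' opA.
  by rewrite [RHS]local_opE ?opP // e' local_opE // opA.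
- move=> y yL; rewrite -[c in local_op c]op1 // local_opE // op1 //.
  exact: local_sub.
- move=> x /local_setP[m [_ [mP _ -> _]]].
  by rewrite local_opE // local_unit_in.
Qed.

Lemma card_local_set :
  {in P, forall m, op m c != e} -> (#|local_set| < #|P|)%N.
Proof.
case: monP => eP _ _ _ _ nc; apply: proper_card; apply/properP.
split; first by apply/fintype.subsetP => x /local_sub.
exists e => //; apply/negP => /local_setP[m [_ [mP _ /esym/eqP mce _]]].
by move: (nc m mP); rewrite mce.
Qed.

(** A word is factored around the letters of value c.  In the words rewritten
    for the outer blocks, [None] stands for an erased letter.  Letters of value
    c are erased by [masked], so that the outer blocks do not use c. *)
Section Factorization.
Variables (L : Type) (h : L -> T).
Hypothesis hP : forall a, h a \in P.
Let is_c : pred L := fun a => h a == c.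

Definition masked (o : option L) : T :=
  if o is Some a then if is_c a then e else h a else e.

Definition keep_before (b : bool) (a : L) (_ : bool) : option L :=
  if b then None else Some a.
Definition keep_after (_ : bool) (a : L) (b : bool) : option L :=
  if b then None else Some a.

Definition first_block (w : seq L) : T :=
  word_value op e masked (transduce (has is_c) keep_before [::] w [::]).
Definition last_block (w : seq L) : T :=
  word_value op e masked (transduce (has is_c) keep_after [::] w [::]).

(** Clipping makes the letters of the middle word range over the local divisor
    for every transduced word; [mark] produces no letter that it changes. *)
Definition in_local (x : T) : T := if x \in local_set then x else c.

(** Each letter of value c that is not the last one contributes c w c, where w
    is the block up to the next letter of value c; this is the first block of
    the suffix.  All other letters contribute the unit c of the local divisor. *)
Definition mark (_ : bool * T) (a : L) (v : bool * T) : T :=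
  if is_c a && v.1 then op (op c v.2) c else c.

Definition middle_block (w : seq L) : T :=
  word_value local_op c in_local
    (transduce (fun u => (has is_c u, first_block u)) mark [::] w [::]).

Lemma masked_in o : masked o \in P.
Proof. by case: monP => eP _ _ _ _; case: o => [a|] //=; case: ifP. Qed.

Lemma in_local_in x : in_local x \in local_set.
Proof. by rewrite /in_local; case: ifP => // _; apply: local_unit_in. Qed.

Lemma first_block_in w : first_block w \in P.
Proof. exact: word_value_in monP masked_in. Qed.

Lemma last_block_in w : last_block w \in P.
Proof. exact: word_value_in monP masked_in. Qed.

Lemma middle_block_in w : middle_block w \in local_set.
Proof. exact: word_value_in local_monoid in_local_in. Qed.

Lemma first_block_after pre w :
  has is_c pre ->
  word_value op e masked (transduce (has is_c) keep_before pre w [::]) = e.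
Proof.
have [eP _ _ op1 _] := monP.
elim: w pre => [|a w IH] pre cpre //=; rewrite cpre /= IH ?op1 //.
by rewrite -cats1 has_cat cpre.
Qed.

(** A prefix is consulted only for the presence of c. *)
Lemma first_block_before pre w :
  ~~ has is_c pre ->
  word_value op e masked (transduce (has is_c) keep_before pre w [::]) =
  first_block w.
Proof.
(* The induction compares two arbitrary prefixes without c. *)
suff indep pre' : ~~ has is_c pre -> ~~ has is_c pre' ->
    word_value op e masked (transduce (has is_c) keep_before pre w [::]) =
    word_value op e masked (transduce (has is_c) keep_before pre' w [::]).
  by move=> cpre; apply: indep.
elim: w pre pre' => [|a w IH] pre pre' //= cpre cpre'.
rewrite (negbTE cpre) (negbTE cpre') /=; case: ifP => ac.
  by rewrite !first_block_after // -cats1 has_cat /= ac orbT.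
by congr op; apply: IH; rewrite -cats1 has_cat /= ac !orbF.
Qed.

Lemma first_block_cons a w :
  first_block (a :: w) = if is_c a then e else op (h a) (first_block w).
Proof.
have [eP _ _ op1 _] := monP.
rewrite {1}/first_block /=; case: ifP => ac.
  by rewrite first_block_after ?op1 //= ac.
by rewrite first_block_before //= ac.
Qed.

Lemma transduce_suffix (A L' : Type) (alpha : seq L -> A) (k : A -> L -> A -> L')
    pre pre' w post :
  (forall u u' a v, k u a v = k u' a v) ->
  transduce alpha k pre w post = transduce alpha k pre' w post.
Proof. by move=> ek; elim: w pre pre' => //= a w IH pre pre'; congr cons. Qed.

Lemma last_block_cons a w :
  last_block (a :: w) =
  if is_c a || has is_c w then last_block w else op (h a) (last_block w).
Proof.
have [eP _ _ op1 _] := monP.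
rewrite {1}/last_block /= cats0 (transduce_suffix _ _ [::]) // -/(last_block w).
by case: (has is_c w); rewrite ?orbT ?orbF /=; last case: ifP => _;
  rewrite ?op1 ?last_block_in.
Qed.

Lemma middle_block_cons a w :
  middle_block (a :: w) =
  if is_c a && has is_c w
  then local_op (op (op c (first_block w)) c) (middle_block w)
  else middle_block w.
Proof.
have [eP opP opA op1 opr1] := monP.
rewrite {1}/middle_block /= cats0 (transduce_suffix _ _ [::]) //.
rewrite -/(middle_block w) /mark /=; case: (is_c a && has is_c w).
  have fP := first_block_in w; rewrite /in_local ifT //; apply/local_setP.
  exists (op c (first_block w)), (op (first_block w) c).
  by rewrite !opP // opA.
have [_ _ _ lop1 _] := local_monoid.
by rewrite /in_local local_unit_in lop1 ?middle_block_in.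
Qed.

(** By induction on the word, from the left.  A new letter outside c joins the
    first block.  A new letter of value c closes it: if c occurs later, then
    (c w c) o (c y) = c w c y in the local divisor; otherwise the middle block
    is its unit c and the former first block is the last block. *)
Lemma block_factorization w :
  word_value op e h w =
  if has is_c w then op (op (first_block w) (middle_block w)) (last_block w)
  else first_block w.
Proof.
have [eP opP opA op1 opr1] := monP.
have no_c u : ~~ has is_c u ->
    first_block u = last_block u /\ middle_block u = c.
  elim: u => [|a u IH] // ; rewrite /= negb_or => /andP[ac uc].
  rewrite first_block_cons last_block_cons middle_block_cons.
  by rewrite (negbTE ac) (negbTE uc) /=; have [-> ->] := IH uc.
elim: w => [|a w /= ->] //.
rewrite first_block_cons last_block_cons middle_block_cons.
have [[fP lP] mL] := (first_block_in w, last_block_in w, middle_block_in w).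
have mP := local_sub mL.
have haP := hP a.
move: (no_c w); case: (has is_c w) => nc; rewrite ?orbT ?orbF ?andbT ?andbF /=.
  case: ifP => [/eqP ->|_]; last by rewrite !opA ?opP.
  by rewrite op1 // local_opE ?opP // !opA ?opP.
have [<- ->] := nc isT.
by case: (boolP (is_c a)) => // /eqP ->; rewrite op1.
Qed.

Lemma recognizable_peel :
  recognizable (word_value op e masked) ->
  recognizable (word_value local_op c in_local) ->
  recognizable (word_value op e h).
Proof.
move=> rm rl.
have rc : recognizable (has is_c) by exact: recognizable_has.
have rfst := recognizable_transduce keep_before rc rm.
have rlst := recognizable_transduce keep_after rc rm.
have rmid := recognizable_transduce mark rfst rl.
have := recognizable_pair (recognizable_pair rfst rlst) rmid.
pose glue (t : bool * T * (bool * T) * (bool * T * T)) : T :=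
  if t.1.1.1 then op (op t.1.1.2 t.2.2) t.1.2.2 else t.1.1.2.
move=> /(recognizable_comp glue); apply: recognizable_ext => w.
by rewrite block_factorization.
Qed.

End Factorization.
End LocalDivisor.

(** Right multiplication by a left invertible x maps P onto P, hence permutes P
    since P is finite; a word is evaluated by applying to e the product of the
    permutations of its letters. *)
Lemma recognizable_units (T : finType) (op : T -> T -> T) e (P : {set T})
    (L : Type) (h : L -> T) :
  monoid_on op e P ->
  (forall a, h a \in P) -> (forall a, exists2 m, m \in P & op m (h a) = e) ->
  recognizable (word_value op e h).
Proof.
move=> monP hP hinv; have [eP opP opA op1 opr1] := monP.
have /choice[s sE] : forall a, exists s : {perm T}, {in P, forall t, s t = op t (h a)}.
  move=> a; have [m mP mh] := hinv a.
  have onto : [set op t (h a) | t in P]%SET = P.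
    apply/finset.setP => t; apply/imsetP/idP => [[t' t'P ->]|tP]; first exact: opP.
    by exists (op t m); rewrite ?opP // -opA // mh opr1.
  have /imset_injP inj : #|[set op t (h a) | t in P]%SET| == #|P| by rewrite onto.
  have injf : injective (fun t => if t \in P then op t (h a) else t).
    move=> t t'; case: ifP => tP; case: ifP => t'P //.
    - exact: inj.
    - by move=> e'; move: t'P; rewrite -e' opP.
    - by move=> e'; move: tP; rewrite e' opP.
  by exists (perm injf) => t tP; rewrite permE tP.
have rs : recognizable (word_value *%g 1 s).
  by apply: (recognizable_group (G := [group of [set: {perm T}]%SET])) => a; rewrite inE.
have := recognizable_comp (fun p : {perm T} => p e) rs.
apply: recognizable_ext => w.
suff valE t : t \in P -> (word_value *%g 1 s w : {perm T}) t = op t (word_value op e h w).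
  by rewrite valE // op1 // (word_value_in _ monP).
elim: w t => [|a w IH] t tP /=; first by rewrite perm1 opr1.
by rewrite permM sE // IH ?opP // opA // (word_value_in _ monP).
Qed.

(** Letters are allowed to have the value e besides the generators in Q, since
    erased letters are given that value. *)
Lemma recognizable_monoid (T : finType) (op : T -> T -> T) e (P : {set T})
    (L : Type) (h : L -> T) :
  monoid_on op e P -> (forall a, h a \in P) -> recognizable (word_value op e h).
Proof.
have [n] := ubnP #|P|; elim: n => // n IHn in op e P L h *.
rewrite ltnS => lePn monP hP.
have hQ a : h a = e \/ h a \in P by right.
move: {1}P hQ => Q hQ; have [m] := ubnP #|Q|.
elim: m => // m IHm in L h hP Q hQ *; rewrite ltnS => leQm.
have [eP opP opA op1 opr1] := monP.
have [hinv|] := pselect (forall a, exists2 m, m \in P & op m (h a) = e).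
  exact: recognizable_units monP hP hinv.
move=> /existsNP[a0 ninv]; pose c := h a0.
have nc : {in P, forall m, op m c != e}.
  by move=> x xP; apply/eqP => xc; apply: ninv; exists x.
(* The value e has a left inverse, so c is one of the generators. *)
have cQ : c \in Q.
  by case: (hQ a0) => // ce; move: (nc _ eP); rewrite /c ce op1 ?eqxx.
apply: (recognizable_peel (c := c) monP) => //; first exact: hP.
  apply: (IHm _ _ _ (Q :\ c)%SET).
  - exact: (masked_in _ monP hP).
  - case=> [a|] /=; last by left.
    case: ifP => [_|/negbT ac]; first by left.
    by case: (hQ a) => [->|aQ]; [left|right; rewrite !inE ac].
  - by apply: leq_trans leQm; rewrite [X in (_ < X)%N](cardsD1 c) cQ.
have cP : c \in P by exact: hP.
apply: (IHn _ _ (local_set op c P)).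
- by apply: leq_trans lePn; apply: (card_local_set monP).
- exact: (local_monoid monP).
- exact: (in_local_in monP).
Qed.

(** * Division *)

Lemma divides_of_recognizable (A : semigroupType) :
  [set: A] !=set0 ->
  recognizable (semigroup_value (@id A)) ->
  exists B : semigroupType, iterated_lrprod B /\ divides A B.
Proof.
move=> [a0 _] [B CB [g gP]]; exists B; split=> //.
pose U : set B := [set b | exists w, semigroup_value g w = Some b].
pose F := fiber_value (semigroup_value g) (semigroup_value (@id A)) None.
have FE w : F (semigroup_value g w) = semigroup_value (@id A) w.
  exact: fiber_valueE.
exists U, (fun b => odflt a0 (F (Some b))).
have some w b : semigroup_value g w = Some b ->
    exists a, semigroup_value (@id A) w = Some a.
  case: w => [|a w] //= _; case: (semigroup_value _ w) => [x|]; by eexists.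
split.
- split; first by exists (g a0), [:: a0].
  move=> x y [w ew] [w' ew']; exists (w ++ w').
  by rewrite semigroup_value_cat ew ew'.
- move=> x y [w ew] [w' ew'].
  have [[a ea] [a' ea']] := (some _ _ ew, some _ _ ew').
  have exy : semigroup_value g (w ++ w') = Some (x * y).
    by rewrite semigroup_value_cat ew ew'.
  by rewrite -exy -ew -ew' !FE semigroup_value_cat ea ea'.
- apply/seteqP; split=> // a _; exists (g a); first by exists [:: a].
  by rewrite -[Some (g a)]/(semigroup_value g [:: a]) FE.
Qed.

Theorem corollary1 (A : semigroupType)
  (A_nonempty : [set: A] !=set0) (A_finite : finite_set [set: A]) :
  exists B : semigroupType, iterated_lrprod B /\ divides A B.
Proof.
apply: divides_of_recognizable => //.
(* A itself has no canonical finType structure: its copy X as a finite subset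
   of A does, and A is evaluated in X with a unit adjoined. *)
have /finite_fsetP[X AX] := A_finite.
have inX a : a \in X by have : [set: A] a by []; rewrite AX.
pose toX a : X := [` inX a]%fset.
pose op := adjoin_one (fun x y : X => toX (val x * val y)).
have opA : associative op.
  by apply: adjoin_oneA => x y z; apply: val_inj; rewrite /= mulgA.
have rX : recognizable (word_value op None (fun a => Some (toX a))).
  apply: (@recognizable_monoid _ _ _ [set: option X]%SET) => [|a]; last by rewrite inE.
  split=> [|x y _ _|x y z _ _ _|x _|x _]; rewrite ?inE //.
  exact: adjoin_one0.
have := recognizable_comp (omap val) rX; apply: recognizable_ext => w.
elim: w => [|a w /= <-] //=.
by case: (word_value _ _ _ _).
Qed.
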